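(* Let $n \ge 2$ be a fixed integer. For a real number $V \ge 1$, let $N_n(V)$ denote the number of subgroups $L \subseteq \mathbb{Z}^n$ of finite index $[\mathbb{Z}^n : L] \le V$ such that the factor group $\mathbb{Z}^n/L$ is cyclic. Define $$\vartheta_n = \prod_{p} \left(1 + \frac{p^{n-1}-1}{p^{n+1}-p^{n}}\right),$$ where the product runs over all prime numbers $p$ (it converges absolutely). Then $$N_n(V) = \frac{\vartheta_n}{n} V^n + O\left(V^{n-1+o(1)}\right)$$ as $V \to \infty$.
   Context: Subgroups of finite index in $\mathbb{Z}^n$ are exactly the full-rank integer lattices contained in $\mathbb{Z}^n$, and the index $[\mathbb{Z}^n:L]$ equals the determinant (co-volume) of $L$. The implied constants in $O(\cdot)$ and the $o(1)$ may depend on $n$. *)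

(* Defs.v *)
From HB Require Import structures.
From mathcomp Require Import all_boot all_order all_algebra finmap.
From mathcomp Require Import all_classical all_reals all_analysis.

Set Implicit Arguments.
Unset Strict Implicit.
Unset Printing Implicit Defensive.
Import Order.TTheory GRing.Theory Num.Theory.
Import numFieldNormedType.Exports.
Local Open Scope classical_set_scope.
Local Open Scope ring_scope.

(* Lets the Landau notations be used at +oo. *)
Canonical pinfty_filter_on (R : numFieldType) : filter_on R :=
  FilterType (pinfty_nbhs R) _.

(* Elements of [zmodClosed A] are the subgroups of A, and [Quotient.quot L],
   a zmodType, is the factor group A / L. *)

Definition finite_index (A : zmodType) (L : zmodClosed A) : Prop :=
  finite_set [set: Quotient.quot L].

(* Only meaningful under [finite_index]: fset_set sends infinite sets to the
   empty one. *)
Definition group_index (A : zmodType) (L : zmodClosed A) : nat :=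
  #|` fset_set [set: Quotient.quot L] |%fset.

Definition cyclic_zmod (A : zmodType) : Prop :=
  exists g : A, forall x : A, exists m : int, x = g *~ m.

(* Subgroups are represented by their underlying sets, so that two
   [zmodClosed] structures on the same predicate are counted once. *)
Definition cocyclic_subgroups (R : realType) (n : nat) (V : R) :
    set (set 'rV[int]_n) :=
  [set [set` L] | L in [set L : zmodClosed 'rV[int]_n |
    [/\ finite_index L, (group_index L)%:R <= V & cyclic_zmod (Quotient.quot L)]]].
Arguments cocyclic_subgroups {R} n V.

Definition count_cocyclic (R : realType) (n : nat) (V : R) : nat :=
  #|` fset_set (cocyclic_subgroups n V) |%fset.
Arguments count_cocyclic {R} n V.

Definition theta_term (R : realType) (n p : nat) : R :=
  (p%:R ^+ n.-1 - 1) / (p%:R ^+ n.+1 - p%:R ^+ n).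

Definition theta (R : realType) (n : nat) : R :=
  limn (fun m : nat => \prod_(0 <= p < m | prime p) (1 + theta_term R n p)).

(* Main.v *)
(* A subgroup with cyclic quotient of order d is L_a = {x : d | a.x} for a tuple
   a in [0, d)^n with gcd (a_1, ..., a_n, d) = 1, and L_a = L_b iff a and b
   differ by a unit mod d.  Hence there are J_n(d) / phi(d) of them, that is
   d^(n-1) prod_(p | d) (1 + p h(p)), where h(p) is [theta_term] at p.
   Expanding the product over the sets J of primes below some m
   and summing over d <= V gives
     sum_J h(J) e(J)^n sum_(b <= V / e(J)) b^(n-1),
   where e(J) and h(J) are the products over J of p and h(p).  The inner sum is
   (V / e)^n / n + O((V / e)^(n-1)) when e <= V and 0 otherwise, so the distance
   to V^n / n prod_(p < m) (1 + h(p)) is at most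
     V^(n-1) sum_(e(J) <= V) e(J) h(J) + V^n sum_(e(J) > V) h(J).
   Since h(J) <= 2^|J| / e(J)^2 <= tau(e(J)) / e(J)^2 and J |-> e(J) is injective,
   this is O(V^(n-1) (1 + ln V)^2) uniformly in m; let m tend to infinity. *)

Require Import Defs.
From HB Require Import structures.
From mathcomp Require Import all_boot all_order all_algebra finmap.
From mathcomp Require Import all_classical all_reals all_analysis.
From mathcomp Require Import zify lra.

Set Implicit Arguments.
Unset Strict Implicit.
Unset Printing Implicit Defensive.
Import Order.TTheory GRing.Theory Num.Theory.
Import numFieldNormedType.Exports.
Local Open Scope classical_set_scope.
Local Open Scope ring_scope.

(** * Subgroups with cyclic quotient *)

Definition dotz n (a : 'I_n -> nat) (x : 'rV[int]_n) : int :=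
  \sum_i (a i)%:Z * x 0 i.

Lemma dotzB n (a : 'I_n -> nat) : {morph dotz a : x y / x - y}.
Proof.
by move=> x y; rewrite /dotz -sumrB; apply: eq_bigr => i _; rewrite !mxE mulrBr.
Qed.

Lemma dotzM n (a : 'I_n -> nat) x m : dotz a (x *~ m) = dotz a x * m.
Proof.
have dot0 : dotz a 0 = 0 by rewrite -(subrr 0) dotzB subrr.
have dotN y : dotz a (- y) = - dotz a y by rewrite -[- y]add0r dotzB dot0 sub0r.
have dotD y z : dotz a (y + z) = dotz a y + dotz a z.
  by rewrite -[z in LHS]opprK dotzB dotN opprK.
elim/int_rect: m => [|k IH|k IH]; first by rewrite mulr0z mulr0.
  by rewrite intS mulrzDr mulr1z dotD IH mulrDr mulr1.
by rewrite intS opprD mulrzDr mulrNz mulr1z dotD IH dotN mulrDr mulrN1.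
Qed.

Lemma dotz_delta n (a : 'I_n -> nat) i : dotz a (delta_mx 0 i) = a i.
Proof.
rewrite /dotz (bigD1 i) //= !mxE !eqxx mulr1 big1 ?addr0 // => j ji.
by rewrite mxE (negPf ji) andbF mulr0.
Qed.

(** The initial value [d] is not neutral for [gcdn]: the big operator denotes gcd (a_1, ..., a_n,
    d). *)
Lemma dvdn_big_gcd n (a : 'I_n -> nat) d p :
  (p %| \big[gcdn/d]_i a i)%N = (p %| d)%N && [forall i, (p %| a i)%N].
Proof.
apply/idP/andP => [H|[pd /forallP pa]]; last first.
  by elim/big_ind: _ => // x y px py; rewrite dvdn_gcd px.
split.
  apply: dvdn_trans H _; elim: (index_enum _) => [|i s IH]; first by rewrite big_nil.
  by rewrite big_cons; apply: dvdn_trans (dvdn_gcdr _ _) IH.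
apply/forallP => i; apply: dvdn_trans H _; have := mem_index_enum i.
elim: (index_enum _) => [//|j s IH]; rewrite inE big_cons => /orP[/eqP <-|/IH].
  exact: dvdn_gcdl.
exact/dvdn_trans/dvdn_gcdr.
Qed.

(** The residues modulo [d] attained by [dotz a] include 0, the class of [d], and every a_i (at the
    unit vectors), and Bezout closes them under gcd. *)
Lemma dotz_bezout n (a : 'I_n -> nat) (d : nat) :
  exists x, (d%:Z %| dotz a x - (\big[gcdn/d]_i a i)%:Z)%Z.
Proof.
have dot0 : dotz a 0 = 0 by rewrite -(subrr 0) dotzB subrr.
elim/big_ind: _ => [|g h [x hx] [y hy]|i _].
- by exists 0; rewrite dot0 sub0r rpredN dvdzz.
- have [u [v uv]] := Bezoutz g h; have -> : (gcdn g h)%:Z = u * g + v * h by rewrite uv.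
  exists (x *~ u - y *~ (- v)); rewrite dotzB !dotzM mulrN opprK.
  rewrite [u * _]mulrC [v * _]mulrC opprD addrACA -!mulrBl.
  by rewrite rpredD // dvdz_mulr.
- by exists (delta_mx 0 i); rewrite dotz_delta subrr dvdz0.
Qed.

Definition latz n d (a : 'I_n -> nat) : {pred 'rV[int]_n} :=
  [pred x | (d%:Z %| dotz a x)%Z].

Lemma latz_closed n d (a : 'I_n -> nat) : zmod_closed (latz d a).
Proof.
split; first by rewrite inE -(subrr 0) dotzB subrr dvdz0.
by move=> x y; rewrite !inE => dx dy; rewrite dotzB rpredB.
Qed.

HB.instance Definition _ n d (a : 'I_n -> nat) :=
  GRing.isZmodClosed.Build _ (latz d a) (latz_closed d a).

(** * Finite cyclic quotients and the lattices L_a *)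

Local Open Scope quotient_scope.
Section CyclicQuotient.
Variables (n : nat) (L : zmodClosed 'rV[int]_n).

Lemma pi_quotM (x : 'rV[int]_n) m :
  (\pi_(Quotient.quot L) x) *~ m = \pi_(Quotient.quot L) (x *~ m).
Proof.
by rewrite raddfMz.
Qed.

Lemma quot_eqE (x y : 'rV[int]_n) :
  (\pi_(Quotient.quot L) x == \pi_(Quotient.quot L) y) = (x - y \in L).
Proof. by rewrite Quotient.idealrBE. Qed.

(** Take x with a.x = 1 modulo [d]. Every y is then congruent to (a.y) x modulo [L], and k x depends
    exactly on k modulo [d], so the quotient is cyclic of order [d] on the class of x. [L] is any
    subgroup with the members of [latz d a], so that two presentations of one subgroup can be
    compared. *)
Lemma latz_quotient d (a : 'I_n -> nat) :
    (0 < d)%N -> \big[gcdn/d]_i a i = 1%N -> L =i latz d a ->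
  [/\ finite_index L, group_index L = d & cyclic_zmod (Quotient.quot L)].
Proof.
move=> d0 prim hL; have [x] := dotz_bezout a d; rewrite prim => hx.
have gen y : \pi_(Quotient.quot L) y = \pi_(Quotient.quot L) x *~ dotz a y.
  rewrite pi_quotM; apply/eqP; rewrite quot_eqE hL inE dotzB dotzM.
  by rewrite -[X in X - _]mul1r -mulrBl dvdz_mulr // -opprB rpredN.
pose f (k : 'I_d) := \pi_(Quotient.quot L) (x *~ k%:Z).
have f_inj : injective f.
  move=> k l /eqP; rewrite quot_eqE hL inE dotzB !dotzM -mulrBr => dkl.
  have : (d%:Z %| k%:Z - l%:Z)%Z.
    rewrite -[_ - _]mul1r -[1](subrK (dotz a x)) mulrDl rpredD //.
    by rewrite dvdz_mulr // -opprB rpredN.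
  rewrite -eqz_mod_dvd !modz_nat => /eqP[]; rewrite !modn_small // => kl.
  exact: val_inj.
have setTE : [set: Quotient.quot L] = [set` [fset f k | k in 'I_d]%fset].
  rewrite eqEsubset; split => // q _ /=; apply/imfsetP.
  pose k := (dotz a (repr q) %% d)%Z.
  have k0 : 0 <= k by rewrite modz_ge0 // eqz_nat -lt0n.
  have kE : k = `|k|%N%:Z by rewrite gez0_abs.
  have kd : (`|k| < d)%N by rewrite -ltz_nat -kE ltz_pmod.
  exists (Ordinal kd) => //=; rewrite /f /= -kE -[LHS]reprK gen pi_quotM.
  apply/eqP; rewrite quot_eqE hL inE dotzB !dotzM -mulrBr dvdz_mull //.
  by rewrite /k -eqz_mod_dvd modz_mod.
split.
- by rewrite /finite_index setTE.
- by rewrite /group_index setTE set_fsetK card_imfset //= -cardE card_ord.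
- exists (\pi x) => q; exists (dotz a (repr q)); rewrite -gen.
  by rewrite reprK.
Qed.

(** By the pigeonhole principle two multiples of [g] coincide, so some positive multiple vanishes.
    For the least such k, the remainder of m modulo k also kills [g] when m does, hence is 0. *)
Lemma cyclic_torsion_order (g : Quotient.quot L) : finite_index L ->
  exists2 k, (0 < k)%N & forall m : int, (g *~ m == 0) = (k%:Z %| m)%Z.
Proof.
move=> fin; pose s : seq (Quotient.quot L) := fset_set [set: Quotient.quot L].
have ex : exists k, (0 < k)%N && (g *+ k == 0).
  pose t := [seq g *+ i | i <- iota 0 (size s).+1].
  have /uniqPn : ~~ uniq t.
    apply/negP => ut; have ts : {subset t <= s} by move=> q _; rewrite in_fset_set // inE.
    by have := uniq_leq_size ut ts; rewrite size_map size_iota ltnn.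
  move=> /(_ 0)[i [j [ij]]]; rewrite size_map size_iota => js.
  rewrite !(nth_map 0%N) ?size_iota // ?(ltn_trans ij) //.
  rewrite !nth_iota ?(ltn_trans ij) // !add0n => gij.
  by exists (j - i)%N; rewrite subn_gt0 ij mulrnBr 1?ltnW // gij subrr eqxx.
case: (ex_minnP ex) => k /andP[k0 /eqP gk] kmin; exists k => // m.
have gM q : g *~ (q * k%:Z) = 0 by rewrite mulrC mulrzA -pmulrn gk mul0rz.
apply/eqP/idP => [gm|/dvdzP[q ->]]; last exact: gM.
have r0 : 0 <= (m %% k)%Z by rewrite modz_ge0 // eqz_nat -lt0n.
have rE : (m %% k)%Z = `|(m %% k)%Z|%N%:Z by rewrite gez0_abs.
apply/dvdz_mod0P; rewrite rE; congr Posz; apply/eqP; apply: contraT => rn.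
have : (k <= `|(m %% k)%Z|)%N.
  apply: kmin; rewrite lt0n rn pmulrn -rE /=.
  by move: gm; rewrite {1}(divz_eq m k) mulrzDr gM add0r => ->.
by rewrite leqNgt -ltz_nat -rE ltz_pmod.
Qed.

(** Let g generate the quotient, of order k, and let the class of the i-th unit vector be m_i g.
    With a_i = m_i modulo k, the class of x is (a.x) g, which vanishes iff k divides a.x. *)
Lemma cyclic_quotient_latz :
    finite_index L -> cyclic_zmod (Quotient.quot L) ->
  exists d (a : 'I_n -> nat), [/\ (0 < d)%N, forall i, (a i < d)%N,
    \big[gcdn/d]_i a i = 1%N & L =i latz d a].
Proof.
move=> fin [g gen]; have [k k0 ordg] := cyclic_torsion_order g fin.
pose b i := \pi_(Quotient.quot L) (delta_mx 0 i : 'rV_n).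
pose m i := sval (cid (gen (b i))).
have mE i : b i = g *~ m i by rewrite /m; case: cid.
pose a i := `|(m i %% k)%Z|%N.
have aE i : (a i)%:Z = (m i %% k)%Z.
  by rewrite gez0_abs // modz_ge0 // eqz_nat -lt0n.
have piE x : \pi_(Quotient.quot L) x = g *~ dotz a x.
  rewrite {1}[x]row_sum_delta raddf_sum /dotz.
  rewrite (big_morph _ (mulrzDr g) (mulr0z g)).
  apply: eq_bigr => i _; transitivity (b i *~ x 0 i).
    by rewrite -[x 0 i in LHS]intz scaler_int raddfMz.
  rewrite mE -mulrzA.
  apply/eqP; rewrite -subr_eq0 -mulrzBr ordg -mulrBl aE dvdz_mulr //.
  by rewrite -eqz_mod_dvd modz_mod.
exists k, a; split => //.
- by move=> i; rewrite -ltz_nat aE ltz_pmod.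
(* Since g is itself the class of a vector, a.(repr g) = 1 modulo k; a common divisor of k and all
   a_i therefore divides 1. *)
- have := piE (repr g); rewrite reprK -[X in X = _]mulr1z => /eqP.
  rewrite -subr_eq0 -mulrzBr ordg => kx.
  have : (\big[gcdn/k]_i a i %| 1)%N; last by rewrite dvdn1 => /eqP.
  have := dvdnn (\big[gcdn/k]_i a i); rewrite dvdn_big_gcd => /andP[Gk /forallP Ga].
  set G := \big[gcdn/k]_i a i in Gk Ga *.
  have : (G%:Z %| 1 - dotz a (repr g))%Z by apply: dvdz_trans kx.
  have : (G%:Z %| dotz a (repr g))%Z.
    by rewrite /dotz rpred_sum // => i _; apply: dvdz_mulr; apply: Ga.
  by move=> h1 h2; have := rpredD h2 h1; rewrite subrK.
- by move=> x; rewrite inE -ordg -piE -[x in LHS]subr0 -quot_eqE raddf0.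
Qed.

End CyclicQuotient.

(** * Primitive tuples up to units, and the subgroups of a given index *)

Definition primitive_tuples n d : {set {ffun 'I_n -> 'I_d}} :=
  [set a : {ffun 'I_n -> 'I_d} | \big[gcdn/d]_i (a i : nat) == 1%N]%SET.

Definition latset n d (a : {ffun 'I_n -> 'I_d}) : set 'rV[int]_n :=
  [set` latz d (fun i => a i : nat)].

Lemma mem_latset n d (a : {ffun 'I_n -> 'I_d}) x :
  latset a x = (d%:Z %| dotz (fun i => a i : nat) x)%Z :> Prop.
Proof. by []. Qed.

Lemma card_coprime_ord d : #|[set u : 'I_d | coprime d u]%SET| = totient d.
Proof.
rewrite totient_count_coprime big_mkord -sum1_card [LHS]big_mkcond; apply: eq_bigr => u _.
by rewrite inE; case: coprime.
Qed.

Section Fibre.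
Variables (n d : nat).
Hypothesis d0 : (0 < d)%N.
Implicit Types (a b : {ffun 'I_n -> 'I_d}) (u : 'I_d).

Definition dilate a u : {ffun 'I_n -> 'I_d} :=
  [ffun i => Ordinal (ltn_pmod (u * a i) d0)].

Lemma modn_eqE k l : (k == l %[mod d])%N = (d%:Z %| k%:Z - l%:Z)%Z.
Proof. by rewrite -eqz_mod_dvd !modz_nat eqz_nat. Qed.

Lemma dotz_dilate a u x :
  (d%:Z %| dotz (fun i => dilate a u i : nat) x - u%:Z * dotz (fun i => a i : nat) x)%Z.
Proof.
rewrite /dotz mulr_sumr -sumrB rpred_sum // => i _; rewrite ffunE /= mulrA -mulrBl.
by rewrite dvdz_mulr // -PoszM -modn_eqE modn_mod.
Qed.

Lemma primitive_bezout a : a \in primitive_tuples n d ->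
  exists x, (d%:Z %| dotz (fun i => a i : nat) x - 1)%Z.
Proof.
rewrite inE => /eqP ap; have [x] := dotz_bezout (fun i => a i : nat) d.
by rewrite ap; exists x.
Qed.

(** For g dividing [d], g divides b_i iff it divides u a_i. If b is primitive, take g = gcd (d, u).
    If u is a unit, take g to be the gcd of [d] and all b_i: it is coprime to u, hence divides every
    a_i. *)
Lemma primitive_mul_mod a b (u : nat) : a \in primitive_tuples n d ->
    (forall i, b i = u * a i %[mod d])%N ->
  (b \in primitive_tuples n d) = coprime d u.
Proof.
rewrite inE => /eqP ap bua.
have dvdb g : (g %| d)%N -> forall i, (g %| b i)%N = (g %| u * a i)%N.
  by move=> gd i; rewrite /dvdn -(modn_dvdm (b i) gd) bua modn_dvdm.
rewrite inE; apply/eqP/idP => [bp|du].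
  rewrite /coprime -dvdn1 -bp dvdn_big_gcd dvdn_gcdl /=.
  by apply/forallP => i; rewrite dvdb ?dvdn_gcdl // dvdn_mulr ?dvdn_gcdr.
apply/eqP; rewrite -dvdn1; set g := \big[gcdn/d]_i (b i : nat).
have : (g %| g)%N by []; rewrite {2}/g dvdn_big_gcd => /andP[gd /forallP gb].
rewrite -ap dvdn_big_gcd gd; apply/forallP => i.
by rewrite -(@Gauss_dvdr _ u) -?dvdb // (coprime_dvdl gd).
Qed.

(** Tuples define the same subgroup exactly when they differ by a unit: multiplying by a unit does
    not affect divisibility by [d], and the converse recovers the unit by evaluating at x with a.x =
    1 modulo [d]. *)
Lemma fibreE a : a \in primitive_tuples n d ->
  [set b in primitive_tuples n d | latset b == latset a]%SET =
  [set dilate a u | u in [set u : 'I_d | coprime d u]]%SET.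
Proof.
move=> ap; have [x hx] := primitive_bezout ap.
have dilE b u : (b \in [set dilate a u]%SET) = [forall i, (b i == u * a i %[mod d])%N].
  rewrite inE; apply/eqP/forallP => [-> i|h]; first by rewrite ffunE /= modn_mod.
  by apply/ffunP => i; apply: val_inj; rewrite ffunE /= -(eqP (h i)) modn_small.
apply/setP => b; rewrite inE; apply/andP/imsetP => [[bp /eqP ba]|[u]].
  (* The candidate unit is b.x modulo [d]. *)
  pose m := (dotz (fun i => b i : nat) x %% d)%Z.
  have mE : m = `|m|%N%:Z by rewrite gez0_abs // modz_ge0 // eqz_nat -lt0n.
  have md : (`|m| < d)%N by rewrite -ltz_nat -mE ltz_pmod.
  have bi i : (b i == `|m| * a i %[mod d])%N.
    (* This vector lies in L_a = L_b, so pairing it with b gives b_i = (b.x) a_i modulo [d]. *)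
    pose y := delta_mx 0 i - x *~ (a i)%:Z.
    have : latset a y.
      rewrite mem_latset dotzB dotz_delta dotzM -[X in X - _]mul1r -mulrBl.
      by rewrite dvdz_mulr // -opprB rpredN.
    rewrite -ba mem_latset dotzB dotz_delta dotzM modn_eqE PoszM -mE.
    move=> h; rewrite -[X in X - _](subrK (dotz (fun j => b j : nat) x * a i)).
    rewrite -addrA rpredD // -mulrBl dvdz_mulr // -eqz_mod_dvd.
    by rewrite modz_mod.
  exists (Ordinal md); last first.
    by apply/eqP; have := dilE b (Ordinal md); rewrite inE => ->; apply/forallP.
  by rewrite inE -(primitive_mul_mod ap (b := b)) // => i; apply/eqP.
rewrite inE => du bE; have := dilE b u; rewrite bE set11 => /esym/forallP h; split.
  by rewrite (primitive_mul_mod ap (u := u)) // => i; apply/eqP.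
apply/eqP; have dvdE y : (d%:Z %| dotz (fun i => dilate a u i : nat) y)%Z =
                         (d%:Z %| dotz (fun i => a i : nat) y)%Z.
  rewrite -[RHS](@Gauss_dvdzr _ u) ?coprimezE //.
  rewrite -[X in X \in _ = _](subrK (u%:Z * dotz (fun i => a i : nat) y)).
  by rewrite rpredDl // dotz_dilate.
rewrite eqEsubset; split => y; rewrite !mem_latset dvdE; exact.
Qed.

(** Distinct units give distinct multiples of a: pairing u a with x, where a.x = 1 modulo [d],
    returns u. *)
Lemma card_fibre a : a \in primitive_tuples n d ->
  #|[set b in primitive_tuples n d | latset b == latset a]%SET| = totient d.
Proof.
move=> ap; have [x hx] := primitive_bezout ap.
rewrite fibreE // card_in_imset ?card_coprime_ord // => u v _ _ uv.
have : (d%:Z %| (u%:Z - v%:Z) * dotz (fun i => a i : nat) x)%Z.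
  rewrite mulrBl; set A := u%:Z * _; set B := v%:Z * _.
  have -> : A - B = (dotz (fun i => dilate a v i : nat) x - B) -
                    (dotz (fun i => dilate a u i : nat) x - A).
    by rewrite uv; lia.
  by rewrite rpredB ?dotz_dilate.
move=> h; have : (d%:Z %| u%:Z - v%:Z)%Z.
  have -> : u%:Z - v%:Z = (u%:Z - v%:Z) * dotz (fun i => a i : nat) x
     - (u%:Z - v%:Z) * (dotz (fun i => a i : nat) x - 1) by lia.
  by rewrite rpredB // dvdz_mull.
rewrite -eqz_mod_dvd !modz_nat => /eqP[]; rewrite !modn_small // => kl.
exact: val_inj.
Qed.

Definition latfset : {fset set 'rV[int]_n} :=
  [fset latset a | a in primitive_tuples n d]%fset.

(** The primitive tuples are grouped by their subgroup, and [card_fibre] gives the size of each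
    group. *)
Lemma card_latfset : (#|` latfset| * totient d)%N = #|primitive_tuples n d|.
Proof.
pose s := [seq latset a | a <- enum (primitive_tuples n d)].
have -> : #|` latfset| = size (undup s).
  apply: perm_size; apply: uniq_perm; rewrite ?fset_uniq ?undup_uniq // => L.
  rewrite mem_undup; apply/imfsetP/mapP => [[a /= ap ->]|[a ap ->]].
    by exists a; rewrite ?mem_enum.
  by exists a; rewrite // -mem_enum.
rewrite cardE -(size_map (@latset n d)) -/s -[RHS]sum1_size.
rewrite -(@big_undup_iterop_count _ 0%N addn _ s xpredT (fun=> 1%N)).
have -> : (size (undup s) * totient d)%N = (\sum_(L <- undup s) totient d)%N.
  by rewrite big_const_seq count_predT iter_addn_0 mulnC.
rewrite [LHS]big_seq [RHS]big_seq; apply: eq_bigr => L.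
rewrite mem_undup => /mapP[a]; rewrite mem_enum => ap ->.
rewrite Monoid.iteropE iter_addn_0 mul1n -(card_fibre ap) count_map.
rewrite -size_filter cardE /enum_mem -filter_predI.
congr size; apply: eq_filter => b; rewrite /= !inE andbC.
by [].
Qed.

End Fibre.

(** By [latz_quotient], [d] and [d'] are both the index of the same subgroup. *)
Lemma latset_index n d d' (a : {ffun 'I_n -> 'I_d}) (a' : {ffun 'I_n -> 'I_d'}) :
    (0 < d)%N -> (0 < d')%N -> a \in primitive_tuples n d ->
    a' \in primitive_tuples n d' -> latset a = latset a' -> d = d'.
Proof.
rewrite !inE => d0 d0' /eqP ap /eqP ap' aa'.
pose L : zmodClosed 'rV[int]_n := latz d (fun i => a i : nat).
have [//|_ <- _] := @latz_quotient n L _ _ d0 ap.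
have LE : L =i latz d' (fun i => a' i : nat).
  move=> x; rewrite !inE; apply/idP/idP.
    by rewrite -!mem_latset aa'.
  by rewrite -!mem_latset -aa'.
by have [_ -> _] := @latz_quotient n L _ _ d0' ap' LE.
Qed.

(** * The count as a sum over the index *)

Definition latfset_upto n N : {fset set 'rV[int]_n} :=
  (\big[fsetU/fset0]_(1 <= d < N.+1) latfset n d)%fset.

Lemma latfset_uptoP n N (X : set 'rV[int]_n) :
  reflect (exists d (a : {ffun 'I_n -> 'I_d}),
     [/\ (0 < d <= N)%N, a \in primitive_tuples n d & X = latset a])
    (X \in latfset_upto n N).
Proof.
apply: (iffP (bigfcupP _ _ _ _)) => [[d]|[d [a [dN ap ->]]]].
  rewrite mem_index_iota andbT => dN /imfsetP[a /= ap ->].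
  by exists d, a.
by exists d; rewrite ?mem_index_iota ?dN //; apply/imfsetP; exists a.
Qed.

Lemma card_latfset_upto n N :
  #|` latfset_upto n N| = (\sum_(1 <= d < N.+1) #|` latfset n d|)%N.
Proof.
elim: N => [|N IH]; first by rewrite /latfset_upto !big_geq ?cardfs0.
rewrite big_nat_recr //= -IH /latfset_upto big_nat_recr //= -/(latfset_upto n N).
rewrite cardfsU; suff -> : (latfset_upto n N `&` latfset n N.+1)%fset = fset0.
  by rewrite cardfs0 subn0.
apply/fsetP => X; rewrite !inE; apply/negP => /andP[/latfset_uptoP[d [a]]].
move=> [/andP[d0 dN] ap ->].
move=> /imfsetP[b /= bp] /(latset_index d0 (ltn0Sn N) ap bp) dE.
by rewrite dE ltnn in dN.
Qed.

(** The hypothesis makes [N] the integer part of [V]. One inclusion is [cyclic_quotient_latz], the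
    other [latz_quotient]. *)
Lemma cocyclic_subgroupsE (R : realType) n (V : R) N :
    (forall d : nat, (d%:R <= V) = (d <= N)%N) ->
  cocyclic_subgroups n V = [set` latfset_upto n N].
Proof.
move=> hV; rewrite eqEsubset; split => [_ [L [fin idx cyc] <-]|X].
  have [d [a [d0 ad ap LE]]] := cyclic_quotient_latz fin cyc.
  apply/latfset_uptoP; exists d, [ffun i => Ordinal (ad i)].
  have aE : \big[gcdn/d]_i ([ffun i => Ordinal (ad i)] i : nat) = 1%N.
    by rewrite -ap; apply: eq_bigr => i _; rewrite ffunE.
  split; rewrite ?inE ?aE //.
    by have [_ idxE _] := latz_quotient d0 ap LE; rewrite d0 -hV -idxE.
  have dotE x : dotz (fun i => [ffun i => Ordinal (ad i)] i : nat) x = dotz a x.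
    by apply: eq_bigr => i _; rewrite ffunE.
  by rewrite eqEsubset; split => x; rewrite mem_latset /= LE inE dotE.
move=> /latfset_uptoP[d [a [/andP[d0 dN] ap ->]]].
rewrite inE in ap; pose L : zmodClosed 'rV[int]_n := latz d (fun i => a i : nat).
have [//|fin idx cyc] := @latz_quotient n L _ _ d0 (eqP ap).
by exists L => //; split; rewrite ?idx ?hV.
Qed.

Lemma count_cocyclicE (R : realType) n (V : R) N :
    (forall d : nat, (d%:R <= V) = (d <= N)%N) ->
  count_cocyclic n V = (\sum_(1 <= d < N.+1) #|` latfset n d|)%N.
Proof.
by move=> hV; rewrite /count_cocyclic (cocyclic_subgroupsE n hV) set_fsetK card_latfset_upto.
Qed.

(** * Counting primitive tuples *)

(* [card_tuples_avoiding] removes the primes of [s] one at a time: the tuples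
   divisible by p are p times the tuples modulo [d / p]. *)
Definition tuples_avoiding n d (s : seq nat) : {set {ffun 'I_n -> 'I_d}} :=
  [set a : {ffun 'I_n -> 'I_d} | all (fun p => ~~ [forall i, (p %| a i)%N]) s]%SET.

Lemma primitive_tuples_avoiding n d : (0 < d)%N ->
  primitive_tuples n d = tuples_avoiding n d (primes d).
Proof.
move=> d0; apply/setP => a; rewrite !inE.
apply/eqP/allP => [ap p|h].
  rewrite mem_primes => /and3P[pp _ pd]; apply/negP => pa.
  have : (p %| \big[gcdn/d]_i (a i : nat))%N by rewrite dvdn_big_gcd pd.
  by rewrite ap dvdn1 => /eqP p1; rewrite p1 in pp.
apply/eqP; apply: contraT => g1.
have g0 : (0 < \big[gcdn/d]_i (a i : nat))%N.
  rewrite lt0n; apply/negP => /eqP g0; have := dvdnn (\big[gcdn/d]_i (a i : nat)).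
  by rewrite dvdn_big_gcd g0 dvd0n (gtn_eqF d0).
have := pdiv_dvd (\big[gcdn/d]_i (a i : nat)); set p := pdiv _.
have pp : prime p by apply: pdiv_prime; rewrite ltn_neqAle eq_sym g1.
rewrite dvdn_big_gcd => /andP[pd pa].
by have := h p; rewrite mem_primes pp d0 pd pa => /(_ isT).
Qed.

(** Multiplication by [p] is the bijection. The primes in [s] differ from [p], so it does not change
    divisibility by them. *)
Lemma card_tuples_avoiding_multiples n d p s : prime p -> all prime s -> p \notin s ->
  #|[set a in tuples_avoiding n (p * d) s | [forall i, (p %| a i)%N]]%SET| =
  #|tuples_avoiding n d s|.
Proof.
move=> pp sp ps; have p0 := prime_gt0 pp.
have lt (i : 'I_d) : (p * i < p * d)%N by rewrite ltn_pmul2l.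
pose f (b : {ffun 'I_n -> 'I_d}) := [ffun i => Ordinal (lt (b i))].
have f_inj : injective f.
  move=> b c /ffunP bc; apply/ffunP => i; apply: val_inj; have /eqP := bc i.
  by rewrite !ffunE -val_eqE /= eqn_pmul2l // => /eqP.
have fE q b : q \in s -> [forall i, (q %| f b i)%N] = [forall i, (q %| b i)%N].
  move=> qs; apply: eq_forallb => i; rewrite ffunE /= Gauss_dvdr //.
  have qp : prime q := allP sp q qs; rewrite prime_coprime // dvdn_prime2 //.
  by apply: contraNneq ps => <-.
transitivity #|[set f b | b in tuples_avoiding n d s]%SET|; last by rewrite card_imset.
apply: eq_card => a; rewrite !inE.
apply/andP/imsetP => [[sa /forallP pa]|[b]].
  have lta i : (a i %/ p < d)%N by rewrite ltn_divLR // [leqRHS]mulnC.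
  have aE : a = f [ffun i => Ordinal (lta i)].
    by apply/ffunP => i; apply: val_inj; rewrite !ffunE /= [RHS]mulnC divnK.
  exists [ffun i => Ordinal (lta i)] => //.
  by rewrite inE; apply/allP => q qs; rewrite -fE // -aE; apply: (allP sa).
rewrite inE => sb ->; split.
  by apply/allP => q qs; rewrite fE //; apply: (allP sb).
by apply/forallP => i; rewrite ffunE /= dvdn_mulr.
Qed.

Lemma card_tuples_avoiding (R : realType) n d (s : seq nat) :
    (0 < d)%N -> uniq s -> all prime s -> all (fun p => p %| d)%N s ->
  #|tuples_avoiding n d s|%:R = d%:R ^+ n * \prod_(p <- s) (1 - p%:R ^- n) :> R.
Proof.
elim: s d => [|p s IH] d d0 /=.
  move=> _ _ _; rewrite big_nil mulr1 -natrX; congr _%:R.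
  rewrite -[in RHS](card_ord d) -[in RHS](card_ord n) -card_ffun -cardsT.
  by apply: eq_card => a; rewrite !inE.
move=> /andP[ps us] /andP[pp sp] /andP[pd sd]; rewrite big_cons.
have [d' dE] := dvdnP pd; rewrite mulnC in dE.
have d0' : (0 < d')%N by move: d0; rewrite dE muln_gt0 => /andP[].
have sd' : all (fun p => p %| d')%N s.
  apply/allP => q qs; have := allP sd q qs; rewrite /= dE Gauss_dvdr //.
  have qp : prime q := allP sp q qs; rewrite prime_coprime // dvdn_prime2 //.
  by apply: contraNneq ps => <-.
have := cardsID [set a : {ffun 'I_n -> 'I_d} | [forall i, (p %| a i)%N]]%SET
                (tuples_avoiding n d s).
move/(congr1 (fun k => k%:R : R)); rewrite natrD IH //.
set X := #|_ :&: _|; have -> : X = #|tuples_avoiding n d' s|.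
  rewrite -(card_tuples_avoiding_multiples n d' pp sp ps) /X -dE.
  by apply: eq_card => a; rewrite !inE.
rewrite IH //; set Y := #|_|; have -> : #|tuples_avoiding n d (p :: s)| = Y.
  by apply: eq_card => a; rewrite !inE /= andbC.
move=> h; have {h}-> : Y%:R = d%:R ^+ n * \prod_(p <- s) (1 - p%:R ^- n) -
  d'%:R ^+ n * \prod_(p <- s) (1 - p%:R ^- n) :> R by rewrite -h addrC addKr.
rewrite mulrA mulrBr mulr1 -mulrBl; congr ((_ - _) * _).
rewrite dE natrM exprMn mulrAC mulfV ?mul1r // expf_neq0 // pnatr_eq0 -lt0n.
exact: prime_gt0.
Qed.

(** This is the product formula for Jordan's totient J_n (d). *)
Lemma card_primitive_tuples (R : realType) n d : (0 < d)%N ->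
  #|primitive_tuples n d|%:R = d%:R ^+ n * \prod_(p <- primes d) (1 - p%:R ^- n) :> R.
Proof.
move=> d0; rewrite primitive_tuples_avoiding // card_tuples_avoiding ?primes_uniq //.
  by apply/allP => p; rewrite mem_primes => /and3P[].
by apply/allP => p; rewrite mem_primes => /and3P[].
Qed.

(** Euler's function is the case n = 1 of Jordan's: a primitive 1-tuple is a residue coprime to
    [d]. *)
Lemma totient_prod (R : realType) d : (0 < d)%N ->
  (totient d)%:R = d%:R * \prod_(p <- primes d) (1 - p%:R^-1) :> R.
Proof.
move=> d0; have := card_primitive_tuples R 1 d0; rewrite expr1 => <-; congr _%:R.
rewrite -card_coprime_ord; apply/esym.
have f_inj : injective (fun (u : 'I_d) => [ffun _ : 'I_1 => u]).
  by move=> u v /ffunP/(_ ord0); rewrite !ffunE.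
transitivity #|[set [ffun _ : 'I_1 => u] | u in [set u : 'I_d | coprime d u]]%SET|;
  last by rewrite card_imset.

apply: eq_card => a; apply/idP/imsetP => [|[u]].
  rewrite inE => ap; exists (a ord0); last by apply/ffunP => i; rewrite ffunE ord1.
  by move: ap; rewrite !inE /coprime big_ord_recl big_ord0 gcdnC.
by rewrite !inE /coprime => du ->; rewrite big_ord_recl big_ord0 ffunE gcdnC.
Qed.

(** The quotient J_n (d) / phi (d) is taken prime by prime: (1 - p^(-n)) / (1 - p^(-1)) = 1 + p
    h(p). *)
Lemma card_latfsetE (R : realType) n d : (0 < d)%N -> (0 < n)%N ->
  #|` latfset n d|%:R =
  d%:R ^+ n.-1 * \prod_(p <- primes d) (1 + p%:R * theta_term R n p) :> R.
Proof.
move=> d0 n0; have dR : d%:R != 0 :> R by rewrite pnatr_eq0 -lt0n.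
have tR : (totient d)%:R != 0 :> R by rewrite pnatr_eq0 -lt0n totient_gt0.
apply: (mulIf tR); rewrite -natrM card_latfset // card_primitive_tuples //.
rewrite totient_prod // -{1}(prednK n0) exprS mulrACA -[d%:R * _]mulrC -big_split /=.
rewrite -!mulrA; congr (_ * (_ * _)); rewrite [LHS]big_seq [RHS]big_seq.
apply: eq_bigr => p; rewrite mem_primes => /and3P[pp _ _].
have p1 : 1 < p%:R :> R by rewrite (_ : 1 = 1%:R) // ltr_nat prime_gt1.
rewrite /theta_term; case: n n0 => // n _ /=; move: p%:R p1 => x x1.
have x0 : x != 0 by lra.
have x10 : x - 1 != 0 by lra.
have X0 : x ^+ n != 0 by rewrite expf_neq0.
(* After the case split [n] is one less than in the statement, so [X] stands for p^(n-1) in the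
   original notation. *)
rewrite !exprS; move: (x ^+ n) X0 => X X0.
have -> : x * (x * X) - x * X = (x - 1) * (x * X) by lra.
have -> : 1 - x^-1 = (x - 1) * x^-1 by rewrite mulrBl mulfV // mul1r.
rewrite !invfM.
have -> : (1 + x * ((X - 1) * ((x - 1)^-1 * (x^-1 * X^-1)))) * ((x - 1) * x^-1) =
  x * x^-1 - x^-1 + (x * x^-1) * ((x - 1) * (x - 1)^-1) * ((X * X^-1) * x^-1 - x^-1 * X^-1).
  by lra.
by rewrite !mulfV // !mul1r subrKA.
Qed.

(** * Sums over sets of primes *)

Section PrimeSubsets.
Variable m : nat.
Implicit Types J K : {set 'I_m}.

Definition prime_set J := [forall i in J, prime i].

Definition set_prod J := (\prod_(i in J) i)%N.

Lemma prod_primes_expand (R : comNzRingType) (g : nat -> R) :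
  \prod_(i < m | prime i) (1 + g i) =
  \sum_(J : {set 'I_m} | prime_set J) \prod_(i in J) g i.
Proof.
(* Being 0 off the primes, [F] removes the subsets containing a nonprime once the product is
   distributed over all subsets. *)
pose F (i : 'I_m) := if prime i then g i else 0.
transitivity (\prod_(i < m) (F i + 1)).
  rewrite big_mkcond; apply: eq_bigr => i _; rewrite /F.
  by case: prime; rewrite ?add0r // addrC.
rewrite bigA_distr [RHS]big_mkcond; apply: eq_bigr => J _.
rewrite -big_mkcond /=; case: ifPn => [/forall_inP Jp|].
  by apply: eq_bigr => i /Jp ip; rewrite /F ip.
rewrite negb_forall_in => /exists_inP[i iJ ip].
by rewrite (bigD1 i) //= /F (negPf ip) mul0r.
Qed.

Lemma dvdn_set_prodP J q : prime_set J -> prime q ->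
  reflect (exists2 i, i \in J & i = q :> nat) (q %| set_prod J)%N.
Proof.
move=> /forall_inP Jp qp; apply: (iffP idP) => [|[i iJ <-]]; last first.
  by rewrite /set_prod (bigD1 i) //= dvdn_mulr.
rewrite /set_prod Euclid_dvd_prod // big_orE => /existsP[i /andP[iJ]].
by rewrite dvdn_prime2 ?Jp // => /eqP ->; exists i.
Qed.

(** A set of primes is recovered from its product as the set of prime divisors. *)
Lemma set_prod_inj J K : prime_set J -> prime_set K -> set_prod J = set_prod K -> J = K.
Proof.
suff H A B : prime_set A -> prime_set B -> set_prod A = set_prod B -> A \subset B.
  by move=> Jp Kp JK; apply/eqP; rewrite finset.eqEsubset !H.
move=> Ap Bp AB; apply/fintype.subsetP => i iA; have ip := forall_inP Ap i iA.
have /(dvdn_set_prodP Bp ip)[j jB /val_inj <- //] : (i %| set_prod B)%N.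
by rewrite -AB; apply/(dvdn_set_prodP Ap ip); exists i.
Qed.

Lemma set_prod_gt0 J : prime_set J -> (0 < set_prod J)%N.
Proof. by move=> /forall_inP Jp; apply: prodn_cond_gt0 => i /Jp /prime_gt0. Qed.

Lemma dvd_set_prodE J d : prime_set J -> (set_prod J %| d)%N = [forall i in J, (i %| d)%N].
Proof.
move=> Jp; apply/idP/forall_inP => [Jd i iJ|].
  by apply: dvdn_trans Jd; rewrite /set_prod (bigD1 i) //= dvdn_mulr.
move: Jp => /forall_inP; rewrite /set_prod -big_enum => Jp Jd.
have {}Jp i : i \in enum J -> prime i by rewrite mem_enum => /Jp.
have {}Jd i : i \in enum J -> (i %| d)%N by rewrite mem_enum => /Jd.
elim: (enum J) (enum_uniq J) Jp Jd => [|i s IH] /=; first by rewrite big_nil dvd1n.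
move=> /andP[iNs us] sp sd; have ip : prime i by rewrite sp ?inE ?eqxx.
rewrite big_cons Gauss_dvd.
  rewrite sd ?inE ?eqxx // IH // => j js; [apply: sp|apply: sd]; by rewrite inE js orbT.
(* A prime dividing a product of primes is one of them, so [i] would lie in [s]. *)
rewrite prime_coprime // Euclid_dvd_prod //; apply: contra iNs.
elim: s sp {us IH sd} => [|j s IH] sp; first by rewrite big_nil.
rewrite big_cons inE dvdn_prime2 ?sp ?inE ?eqxx ?orbT // val_eqE => /orP[->//|/IH ->].
  by rewrite orbT.
by move=> k; rewrite inE => /orP[/eqP->|ks]; apply: sp; rewrite !inE ?eqxx // ks !orbT.
Qed.

(** Turns a sum over sets of primes into a sum over integers: by [set_prod_inj] each k is the
    product of at most one J, and the values of [F] left over are nonnegative. *)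
Lemma sum_set_prod_le (R : realType) (F : nat -> R) M (P : pred {set 'I_m}) :
    (forall k, 0 <= F k) -> (forall J, P J -> prime_set J) ->
    (forall J, P J -> (set_prod J <= M)%N) ->
  \sum_(J | P J) F (set_prod J) <= \sum_(k < M.+1) F k.
Proof.
move=> F0 Pp PM; rewrite (partition_big (fun J => inord (set_prod J) : 'I_M.+1) xpredT) //=.
apply: ler_sum => k _.
case: (pickP [pred J | P J && (inord (set_prod J) == k)]) => [J /= /andP[PJ /eqP Jk]|none].
  rewrite (bigD1 J) /=; last by rewrite PJ Jk eqxx.
  have -> : F k = F (set_prod J) by rewrite -Jk inordK // ltnS PM.
  rewrite big_pred0 ?addr0 // => K; apply/negP => /andP[/andP[PK /eqP Kk] /negP]; apply.
  apply/eqP; apply: set_prod_inj; rewrite ?Pp //.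
  have := congr1 (@nat_of_ord _) (etrans Jk (esym Kk)).
  by rewrite !inordK ?ltnS ?PM.
by rewrite big_pred0.
Qed.

End PrimeSubsets.

(** * Harmonic sums and sums of the divisor function *)

Section DivisorSums.
Variable R : realType.

Lemma sum_multiples (V : nmodType) (F : nat -> V) a N : (0 < a)%N ->
  \sum_(k < N.+1 | (a %| k)%N) F k = \sum_(b < (N %/ a).+1) F (a * b)%N.
Proof.
move=> a0.
rewrite (reindex_onto (fun b : 'I_(N %/ a).+1 => inord (a * b) : 'I_N.+1)
                      (fun k => inord (k %/ a))) /=; last first.
  move=> k ak; apply: val_inj; rewrite /= inordK.
    by rewrite inordK ?ltnS ?leq_div2r -1?ltnS // mulnC divnK.
  rewrite inordK ?ltnS ?leq_div2r -1?ltnS //.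
  by rewrite mulnC divnK.
have abN (b : 'I_(N %/ a).+1) : (a * b < N.+1)%N.
  rewrite ltnS; apply: leq_trans (leq_trunc_div N a).
  by rewrite mulnC leq_mul2r -ltnS ltn_ord orbT.
rewrite [LHS]big_mkcond; apply: eq_bigr => b _; rewrite inordK // dvdn_mulr //= mulKn //.
by rewrite inord_val eqxx.
Qed.

(* The term k = 0 is 0, since 0^-1 = 0. *)
Definition harmonic N : R := \sum_(k < N.+1) k%:R^-1.

(* The number of divisors of k only when 0 < k <= M. *)
Definition ndivisors M k : R := \sum_(a < M.+1) (a %| k)%N%:R.

Lemma harmonic_ge0 N : 0 <= harmonic N.
Proof. by apply: sumr_ge0 => k _; rewrite invr_ge0. Qed.

Lemma harmonic_le M N : (M <= N)%N -> harmonic M <= harmonic N.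
Proof.
move=> MN; rewrite /harmonic -!(big_mkord xpredT (fun k => k%:R^-1)).
rewrite (@big_cat_nat _ _ _ M.+1 0 N.+1) //= lerDl.
by apply: sumr_ge0 => k _; rewrite invr_ge0.
Qed.

(** Exchange the sums over k and its divisor a, then write k = a b. *)
Lemma sum_ndivisors (F : nat -> R) M : F 0 = 0 ->
  \sum_(k < M.+1) ndivisors M k * F k =
  \sum_(a < M.+1) \sum_(b < (M %/ a).+1) F (a * b)%N.
Proof.
move=> F0; under eq_bigr do rewrite mulr_suml.
rewrite exchange_big; apply: eq_bigr => a _ /=.
have [a0|a0] := posnP a; last first.
  rewrite -sum_multiples // [RHS]big_mkcond; apply: eq_bigr => k _.
  by case: dvdn; rewrite ?mul1r ?mul0r.
(* For a = 0 both sides vanish: 0 divides only k = 0, where [F] is 0, and a b = 0 throughout. *)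
rewrite a0 !big1 // => k _; rewrite ?mul0n ?F0 ?mulr0 // dvd0n.
by case: eqP => [->|]; rewrite ?F0 ?mulr0 ?mul0r.
Qed.

(** The left side is the sum of 1 / (a b) over a b <= N, part of the product of two harmonic
    sums. *)
Lemma sum_ndivisors_div N : \sum_(k < N.+1) ndivisors N k * k%:R^-1 <= harmonic N ^+ 2.
Proof.
rewrite (@sum_ndivisors (fun k => k%:R^-1)) ?invr0 // expr2 {1}/harmonic mulr_suml.
apply: ler_sum => a _; under eq_bigr do rewrite natrM invfM.
by rewrite -mulr_sumr ler_wpM2l ?invr_ge0 // harmonic_le // leq_div.
Qed.

Lemma sum_inv_sqr_le k B :
  \sum_(b < B.+1 | (k < b)%N) (b%:R ^- 2 : R) <= 2 / k.+1%:R.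
Proof.
(* The extra - 1 / B lets the induction run, since 1 / (B + 1)^2 <= 1 / B - 1 / (B + 1); the factor
   2 pays for the first term, 1 / (k + 1)^2 <= 1 / (k + 1). *)
suff H : \sum_(b < B.+1 | (k < b)%N) (b%:R ^- 2 : R) <=
    if (k < B)%N then 2 / k.+1%:R - B%:R^-1 else 0.
  by apply: le_trans H _; case: ifP => _; rewrite ?gerBl ?invr_ge0 ?divr_ge0.
elim: B => [|B IH]; first by rewrite big_mkcond big_ord1.
rewrite big_mkcond big_ord_recr -big_mkcond /= ltnS.
have [kB|kB] := ltnP k B.
  rewrite (ltnW kB); rewrite kB in IH; apply: le_trans (lerD IH (lexx _)) _.
  have B0 : 0 < B%:R :> R by rewrite ltr0n (leq_trans _ kB).
  rewrite -addrA lerD2l -natr1; move: B%:R B0 => x x0.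
  have x1 : 0 < x + 1 by lra.
  have -> : x^-1 = (x + 1)^-1 + x^-1 * (x + 1)^-1.
    rewrite -[(x + 1)^-1 in X in X + _]mul1r -mulrDl -{1}(mulVf (lt0r_neq0 x0)).
    by rewrite -[X in _ + X]mulr1 -mulrDr mulfK // lt0r_neq0.
  rewrite opprD -addrA gerDl // -exprVn expr2 addrC subr_le0.
  by rewrite ler_wpM2r ?invr_ge0 ?(ltW x1) // lef_pV2 ?posrE // lerDl.
rewrite ltnNge kB /= in IH.
have [Bk|Bk] := ltnP B k; first by rewrite addr0.
have kE : k = B by apply: anti_leq; rewrite Bk.
apply: le_trans (lerD (_ : _ <= 0) (lexx _)) _.
  by move: IH; rewrite kE.
rewrite kE add0r mulr_natl mulr2n addrK -exprVn expr2 ler_piMr ?invr_ge0 //.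
by rewrite invf_le1 ?ltr0n // ler1n.
Qed.

Lemma sum_inv_narrow M N :
  \sum_(a < M.+1 | (a <= N)%N) (a%:R^-1 : R) = harmonic (minn M N).
Proof.
elim: M => [|M IH]; first by rewrite min0n /harmonic big_mkcond !big_ord1 leq0n.
rewrite big_mkcond big_ord_recr -big_mkcond /= IH.
have [MN|NM] := leqP M.+1 N; last by rewrite (minn_idPr _) // addr0.
by rewrite (minn_idPl (ltnW MN)) /harmonic [RHS]big_ord_recr.
Qed.

(** With k = a b, the sum over b > N / a is at most 2 / (floor (N / a) + 1) by [sum_inv_sqr_le]. For
    a <= N this is at most 2 a / N, and summing 2 / (N a) gives the harmonic term. For a > N the
    floor is 0, and the tail of 2 / a^2 gives 4 / (N + 1). *)
Lemma sum_ndivisors_div_sqr N M : (0 < N)%N ->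
  \sum_(k < M.+1 | (N < k)%N) ndivisors M k * k%:R ^- 2 <=
    2 * harmonic N / N%:R + 4 / N.+1%:R.
Proof.
move=> N0.
pose F k : R := if (N < k)%N then k%:R ^- 2 else 0.
have -> : \sum_(k < M.+1 | (N < k)%N) ndivisors M k * k%:R ^- 2 =
          \sum_(k < M.+1) ndivisors M k * F k.
  by rewrite big_mkcond; apply: eq_bigr => k _; rewrite /F; case: ifP; rewrite ?mulr0.
rewrite sum_ndivisors; last by rewrite /F.
apply: (@le_trans _ _ (\sum_(a < M.+1)
  ((if (a <= N)%N then 2 / N%:R * a%:R^-1 else 0) + 2 * if (N < a)%N then a%:R ^- 2 else 0))).
  apply: ler_sum => a _.
  have [a0|a0] := posnP a.
    by rewrite a0 big1 ?leq0n ?ltn0 ?invr0 ?mulr0 ?addr0 // => b _; rewrite mul0n.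
  have -> : \sum_(b < (M %/ a).+1) F (a * b)%N =
     a%:R ^- 2 * \sum_(b < (M %/ a).+1 | (N %/ a < b)%N) b%:R ^- 2.
    rewrite mulr_sumr [RHS]big_mkcond; apply: eq_bigr => b _.
    by rewrite /F ltn_divLR // [in RHS]mulnC natrM exprMn invfM.
  apply: le_trans (ler_wpM2l _ (sum_inv_sqr_le _ _)) _; first by rewrite invr_ge0 exprn_ge0.
  have aR : 0 < a%:R :> R by rewrite ltr0n.
  have NR : 0 < N%:R :> R by rewrite ltr0n.
  have [aN|Na] := leqP a N.
    have aw : a%:R^-1 * (N %/ a).+1%:R^-1 <= N%:R^-1 :> R.
      rewrite -invfM lef_pV2 ?posrE ?mulr_gt0 ?ltr0n // -natrM ler_nat mulnC ltnW //.
      by rewrite -ltn_divLR.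
    have := ler_wpM2l (_ : 0 <= a%:R^-1) aw; rewrite invr_ge0 ltW // => /(_ isT).
    rewrite mulr0 addr0 -exprVn expr2.
    move: (a%:R^-1 : R) (N%:R^-1 : R) (_.+1%:R^-1 : R) => x y z h; nra.
  by rewrite add0r divn_small // invr1 mulr1 mulrC.
rewrite big_split /= lerD //.
  rewrite -big_mkcond -mulr_sumr sum_inv_narrow [leRHS]mulrAC.
  by rewrite ler_wpM2l ?divr_ge0 // harmonic_le // geq_minr.
rewrite -mulr_sumr -big_mkcond; apply: le_trans (ler_wpM2l _ (sum_inv_sqr_le _ _)) _ => //.
by rewrite mulrA -natrM.
Qed.

End DivisorSums.

(** * Bounds for h(p) and for sums of h(J) *)

Section MainInequality.
Variable R : realType.

Lemma theta_term_ge0 n p : (1 < n)%N -> prime p -> 0 <= theta_term R n p.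
Proof.
case: n => // r _ /prime_gt1 p1; rewrite /theta_term /=.
have p1R : 1 < p%:R :> R by rewrite (_ : 1 = 1%:R) // ltr_nat.
apply: divr_ge0; rewrite subr_ge0; first by rewrite exprn_ege1 ?ltW.
by rewrite [leRHS]exprS ler_peMl // ?exprn_ge0 ?ltW // (lt_trans ltr01).
Qed.

(** As p >= 2, the denominator p^n (p - 1) is at least p^(n+1) / 2. *)
Lemma theta_term_le n p : (1 < n)%N -> prime p -> theta_term R n p <= 2 * p%:R ^- 2.
Proof.
case: n => // r _ /prime_gt1 p1; rewrite /theta_term /=.
have p2R : 2 <= p%:R :> R by rewrite ler_nat.
move: p%:R p2R => x x2; have x0 : 0 < x by lra.
have X0 : 0 < x ^+ r by rewrite exprn_gt0.
have D0 : 0 < x ^+ r.+2 - x ^+ r.+1.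
  by rewrite exprS -[X in _ - X]mul1r -mulrBl mulr_gt0 ?exprn_gt0 //; lra.
rewrite ler_pdivrMr // mulrAC ler_pdivlMr ?exprn_gt0 //.
rewrite !exprS; move: (x ^+ r) X0 => X X0.
have := mulr_ge0 (ltW X0) (mulr_ge0 (ltW x0) (_ : 0 <= x - 2)).
by rewrite subr_ge0 => /(_ x2); nra.
Qed.

Section Weights.
Variables (n m : nat).
Hypothesis n1 : (1 < n)%N.
Implicit Types J : {set 'I_m}.

Definition weight J : R := \prod_(i in J) theta_term R n i.

Lemma weight_ge0 J : prime_set J -> 0 <= weight J.
Proof. by move=> /forall_inP Jp; apply: prodr_ge0 => i /Jp; apply: theta_term_ge0. Qed.

(** The subsets of J have distinct products, all of them divisors of e(J). *)
Lemma exp2_card_le J M : prime_set J -> (set_prod J <= M)%N ->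
  2 ^+ #|J| <= ndivisors R M (set_prod J).
Proof.
move=> Jp JM; rewrite -natrX -card_powerset -sum1_card natr_sum.
have sub (K : {set 'I_m}) : K \in powerset J -> prime_set K /\ (set_prod K %| set_prod J)%N.
  rewrite inE => /fintype.subsetP KJ; move/forall_inP: (Jp) => Jp'.
  have Kp : prime_set K by apply/forall_inP => i /KJ /Jp'.
  split=> //; rewrite dvd_set_prodE //; apply/forall_inP => i iK.
  by apply/(dvdn_set_prodP Jp (Jp' _ (KJ _ iK))); exists i; rewrite ?KJ.
apply: (@le_trans _ _ (\sum_(K in powerset J) (set_prod K %| set_prod J)%N%:R)).
  by apply: ler_sum => K /sub[_ ->].
apply: (@sum_set_prod_le _ _ (fun k => (k %| set_prod J)%N%:R)) => // K /sub[//] _ KJ.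
by apply: leq_trans (dvdn_leq _ KJ) JM; apply: set_prod_gt0.
Qed.

Lemma weight_le J M : prime_set J -> (set_prod J <= M)%N ->
  weight J <= ndivisors R M (set_prod J) * (set_prod J)%:R ^- 2.
Proof.
move=> Jp JM; apply: (@le_trans _ _ (\prod_(i in J) (2 * i%:R ^- 2))).
  move/forall_inP: Jp => Jp.
  by apply: ler_prod => i /Jp ip; rewrite theta_term_ge0 ?theta_term_le.
have -> : \prod_(i in J) (2 * i%:R ^- 2) = 2 ^+ #|J| * (set_prod J)%:R ^- 2 :> R.
  by rewrite /set_prod natr_prod -prodrXl -prodfV big_split prodr_const.
by rewrite ler_wpM2r ?invr_ge0 ?exprn_ge0 // exp2_card_le.
Qed.

Lemma ndivisors_ge0 M k : 0 <= ndivisors R M k.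
Proof. by apply: sumr_ge0. Qed.

(** By [weight_le] a term is at most tau(e(J)) / e(J), so the sum is bounded by that of tau(k) / k
    over k <= N, whatever [m] is. *)
Lemma sum_small_weights N :
  \sum_(J | prime_set J && (set_prod J <= N)%N) (set_prod J)%:R * weight J
    <= harmonic R N ^+ 2.
Proof.
apply: le_trans (sum_ndivisors_div R N).
apply: le_trans (@sum_set_prod_le m R (fun k => ndivisors R N k * k%:R^-1) N
  (fun J => prime_set J && (set_prod J <= N)%N) _ _ _).
- apply: ler_sum => J /andP[Jp JN].
  have J0 : (set_prod J)%:R != 0 :> R by rewrite pnatr_eq0 -lt0n set_prod_gt0.
  apply: le_trans (ler_wpM2l _ (weight_le Jp JN)) _ => //.
  by rewrite mulrCA ler_wpM2l ?ndivisors_ge0 // expr2 invfM mulVKf.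
- by move=> k; rewrite mulr_ge0 ?ndivisors_ge0 ?invr_ge0.
- by move=> J /andP[].
- by move=> J /andP[].
Qed.

Lemma sum_large_weights N : (0 < N)%N ->
  \sum_(J | prime_set J && (N < set_prod J)%N) weight J <=
    2 * harmonic R N / N%:R + 4 / N.+1%:R.
Proof.
(* A crude common bound for all products suffices, as the estimate of [sum_ndivisors_div_sqr] does
   not depend on it. *)
move=> N0; pose M := (\sum_(J : {set 'I_m}) set_prod J)%N.
have JM J : (set_prod J <= M)%N by rewrite /M (bigD1 J) //= leq_addr.
apply: le_trans (sum_ndivisors_div_sqr R M N0).
rewrite [leRHS]big_mkcond.
apply: le_trans (@sum_set_prod_le m R
  (fun k => if (N < k)%N then ndivisors R M k * k%:R ^- 2 else 0) M
  (fun J => prime_set J && (N < set_prod J)%N) _ _ _).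
- by apply: ler_sum => J /andP[Jp JN]; rewrite JN weight_le.
- by move=> k; case: ifP; rewrite // mulr_ge0 ?ndivisors_ge0 ?invr_ge0 ?exprn_ge0.
- by move=> J /andP[].
- by move=> J _.
Qed.

End Weights.

(** * The asymptotic estimate *)

(** The difference is (b - a) times a sum of r + 1 products b^(r-i) a^i, each between a^r and
    b^r. *)
Lemma subrXX_bounds (a b : R) r : 0 <= a -> a <= b ->
  r.+1%:R * a ^+ r * (b - a) <= b ^+ r.+1 - a ^+ r.+1 <= r.+1%:R * b ^+ r * (b - a).
Proof.
move=> a0 ab; have b0 := le_trans a0 ab.
rewrite subrXX; apply/andP; split.
  rewrite mulrC ler_wpM2l ?subr_ge0 //.
  rewrite mulr_natl -[X in _ *+ X](card_ord r.+1) -sumr_const ler_sum // => i _.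
  have -> : a ^+ r = a ^+ (r - i) * a ^+ i by rewrite -exprD subnK // -ltnS.
  by rewrite ler_wpM2r ?exprn_ge0 // lerXn2r.
rewrite [leRHS]mulrC ler_wpM2l ?subr_ge0 //.
rewrite mulr_natl -[X in _ *+ X](card_ord r.+1) -sumr_const ler_sum // => i _.
have -> : b ^+ r = b ^+ (r - i) * b ^+ i by rewrite -exprD subnK // -ltnS.
by rewrite ler_wpM2l ?exprn_ge0 // lerXn2r.
Qed.

(** Here k is the integer part of x. The bounds are first proved at the integer k by induction,
    comparing (k + 1)^(r+1) - k^(r+1) with its derivative bounds; passing from k to x costs at most
    (r + 1) x^r because x - k < 1. *)
Lemma power_sum_approx r k (x : R) : (0 < r)%N -> k%:R <= x -> x < k.+1%:R -> 1 <= x ->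
  `|\sum_(b < k.+1) b%:R ^+ r - x ^+ r.+1 / r.+1%:R| <= x ^+ r.
Proof.
move=> r0 kx xk x1; have x0 : 0 <= x by lra.
have rR : 0 < r.+1%:R :> R by rewrite ltr0n.
pose S k : R := \sum_(b < k.+1) b%:R ^+ r; rewrite -/(S k).
have bounds : k%:R ^+ r.+1 <= r.+1%:R * S k <= k%:R ^+ r.+1 + r.+1%:R * k%:R ^+ r.
  elim: k {kx xk} => [|k IH].
    (* The term b = 0 vanishes only because r > 0, as 0^0 = 1. *)
    have z : (0%:R : R) ^+ r = 0 by rewrite expr0n (gtn_eqF r0).
    by rewrite /S big_ord1 exprS z !mulr0 addr0 lexx.
  have /andP[IH1 IH2] := IH. have kS : k%:R <= k.+1%:R :> R by rewrite ler_nat.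
  have /andP[] := subrXX_bounds r (ler0n R k) kS.
  rewrite -(natrB R (leqnSn k)) subSnn !mulr1 => h1 h2.
  have -> : S k.+1 = S k + k.+1%:R ^+ r by rewrite /S big_ord_recr.
  rewrite mulrDr; apply/andP; split; last by rewrite lerD2r; lra.
  by lra.
have /andP[h1 h2] := bounds; have /andP[_ h3] := subrXX_bounds r (ler0n R k) kx.
have kx1 : x ^+ r.+1 - k%:R ^+ r.+1 <= r.+1%:R * x ^+ r.
  apply: le_trans h3 _; rewrite -[leRHS]mulr1 ler_wpM2l ?mulr_ge0 ?exprn_ge0 //.
  by rewrite -natr1 in xk; lra.
have kxr : k%:R ^+ r.+1 <= x ^+ r.+1 by rewrite lerXn2r ?nnegrE ?ler0n.
have kxr' : r.+1%:R * k%:R ^+ r <= r.+1%:R * x ^+ r.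
  by rewrite ler_wpM2l // lerXn2r ?nnegrE ?ler0n.
rewrite ler_norml -(ler_pM2l rR) -[X in _ && X](ler_pM2l rR).
rewrite mulrBr mulrCA divff ?lt0r_neq0 // mulr1.
by apply/andP; split; lra.
Qed.

End MainInequality.

(** * The count as a sum over sets of primes *)

Section Expansion.
Variable R : realType.

(** Prime divisors of [d] are below [m]; the remaining primes below [m] contribute a factor 1. *)
Lemma prod_primes_dvd (g : nat -> R) d m : (0 < d < m)%N ->
  \prod_(p <- primes d) (1 + g p) =
  \prod_(i < m | prime i) (1 + (i %| d)%N%:R * g i).
Proof.
move=> /andP[d0 dm].
transitivity (\prod_(0 <= i < m | prime i && (i %| d)%N) (1 + g i)).
  rewrite -[RHS]big_filter; apply: perm_big; apply: uniq_perm.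
  - exact: primes_uniq.
  - by rewrite filter_uniq // iota_uniq.
  - move=> p; rewrite mem_primes d0 mem_filter mem_index_iota /=.
    case pp: (prime p) => //=; case pd: (p %| d)%N => //=; apply/esym.
    exact: leq_ltn_trans (dvdn_leq d0 pd) dm.
rewrite big_mkord [LHS]big_mkcond [RHS]big_mkcond; apply: eq_bigr => i _.
by case: prime => //=; case: dvdn; rewrite ?mul1r ?mul0r ?addr0.
Qed.

(** After exchanging the sums over d and J, put d = e(J) b, so that d^(n-1) e(J) = e(J)^n b^(n-1).
    Taking [m] above [N] puts every prime factor of every d <= N in range. *)
Lemma count_expand n N m : (1 < n)%N -> (N < m)%N ->
  (\sum_(1 <= d < N.+1) #|` latfset n d|)%N%:R =
  \sum_(J : {set 'I_m} | prime_set J) weight R n J *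
    ((set_prod J)%:R ^+ n * \sum_(b < (N %/ set_prod J).+1) b%:R ^+ n.-1) :> R.
Proof.
move=> n1 Nm; have n0 : (0 < n)%N by apply: ltnW.
pose G d : R := \sum_(J : {set 'I_m} | prime_set J)
  (set_prod J %| d)%N%:R * ((set_prod J)%:R * weight R n J).
have GE d : (0 < d < m)%N ->
    \prod_(p <- primes d) (1 + p%:R * theta_term R n p) = G d.
  move=> dm; rewrite (prod_primes_dvd (fun p => p%:R * theta_term R n p) dm).
  rewrite (prod_primes_expand m (fun i => (i %| d)%N%:R * (i%:R * theta_term R n i))).
  apply: eq_bigr => J Jp; rewrite dvd_set_prodE // 2!big_split /= -/(weight R n J).
  have -> : (set_prod J)%:R = \prod_(i in J) i%:R :> R by rewrite /set_prod natr_prod.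
  congr (_ * _); case: (boolP [forall i in J, (i %| d)%N]) => [/forall_inP h|].
    by rewrite big1 // => i /h ->.
  rewrite negb_forall_in => /exists_inP[i iJ ni].
  by rewrite (bigD1 i) //= (negPf ni) mul0r.
transitivity (\sum_(d < N.+1) d%:R ^+ n.-1 * G d).
  (* The right side also has the term d = 0, which vanishes because n - 1 > 0. *)
  rewrite natr_sum -(big_mkord xpredT (fun d => d%:R ^+ n.-1 * G d)) [RHS]big_ltn //.
  rewrite expr0n -subn1 subn_eq0 leqNgt n1 mul0r add0r.
  rewrite big_nat_cond [RHS]big_nat_cond; apply: eq_bigr => d /andP[/andP[d0 dN] _].
  by rewrite card_latfsetE // subn1 GE // d0 (leq_trans dN).
under eq_bigr do rewrite mulr_sumr.
rewrite exchange_big; apply: eq_bigr => J Jp /=.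
have e0 := set_prod_gt0 Jp; move: (set_prod J) e0 (weight R n J) => e e0 w.
have -> : \sum_(d < N.+1) d%:R ^+ n.-1 * ((e %| d)%N%:R * (e%:R * w)) =
          \sum_(d < N.+1 | (e %| d)%N) (e%:R * w) * d%:R ^+ n.-1 :> R.
  rewrite [RHS]big_mkcond; apply: eq_bigr => d _.
  by case: dvdn; rewrite ?mul1r ?mul0r ?mulr0 // mulrC.
rewrite (sum_multiples (fun d => (e%:R * w) * d%:R ^+ n.-1)) //.
rewrite -[X in _ ^+ X * _](prednK n0) exprS !mulr_sumr; apply: eq_bigr => b _.
by rewrite natrM exprMn [e%:R * w]mulrC !mulrA.
Qed.

Lemma main_inequality n N m (V : R) : (1 < n)%N -> (0 < N)%N -> (N < m)%N ->
    N%:R <= V -> V < N.+1%:R ->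
  `|(\sum_(1 <= d < N.+1) #|` latfset n d|)%N%:R -
    V ^+ n / n%:R * \prod_(i < m | prime i) (1 + theta_term R n i)| <=
  V ^+ n.-1 * harmonic R N ^+ 2 + V ^+ n * (2 * harmonic R N / N%:R + 4 / N.+1%:R).
Proof.
move=> n1 N0 Nm NV VN; have n0 : (0 < n)%N by apply: ltnW.
have V0 : 0 < V by apply: lt_le_trans NV; rewrite ltr0n.
rewrite (count_expand n1 Nm) prod_primes_expand mulr_sumr -sumrB.
rewrite (bigID (fun J => set_prod J <= N)%N) /=.
apply: le_trans (ler_normD _ _) _; apply: lerD; apply: le_trans (ler_norm_sum _ _ _) _.
  apply: le_trans (ler_wpM2l _ (sum_small_weights R m n1 N)); last by rewrite exprn_ge0 // ltW.
  rewrite mulr_sumr; apply: ler_sum => J /andP[Jp JN].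
  have e0 := set_prod_gt0 Jp; have eR : 0 < (set_prod J)%:R :> R by rewrite ltr0n.
  rewrite -/(weight R n J) [V ^+ n / _ * _]mulrC -mulrBr normrM ger0_norm ?weight_ge0 //.
  rewrite [leRHS]mulrA [leRHS]mulrC ler_wpM2l ?weight_ge0 //.
  move: (set_prod J) e0 eR JN => e e0 eR eN.
  have ne : e%:R != 0 :> R by rewrite lt0r_neq0.
  have xV : e%:R * (V / e%:R) = V by rewrite mulrC divfK.
  have nE : n = n.-1.+1 by rewrite prednK.
  (* Everything is expressed through V / e, so that e^n factors out. *)
  have -> : V ^+ n.-1 * e%:R = e%:R ^+ n * (V / e%:R) ^+ n.-1.
    by rewrite [in e%:R ^+ n]nE exprS -mulrA -exprMn xV mulrC.
  have -> : V ^+ n / n%:R = e%:R ^+ n * ((V / e%:R) ^+ n / n%:R) by rewrite mulrA -exprMn xV.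
  rewrite -mulrBr normrM ger0_norm ?exprn_ge0 // ler_wpM2l ?exprn_ge0 //.
  (* [N %/ e] is the integer part of V / e, and V / e >= 1 because e <= N <= V. *)
  rewrite [in X in _ - X]nE; apply: power_sum_approx.
  - by rewrite -subn1 subn_gt0.
  - rewrite ler_pdivlMr // -natrM; apply: le_trans NV; rewrite ler_nat.
    exact: leq_trunc_div.
  - rewrite ltr_pdivrMr // -natrM; apply: lt_le_trans VN _; rewrite ler_nat.
    exact: ltn_ceil.
  - rewrite ler_pdivlMr // mul1r; apply: le_trans NV; by rewrite ler_nat.
apply: le_trans (ler_wpM2l _ (sum_large_weights R m n1 N0)); last by rewrite exprn_ge0 // ltW.
rewrite mulr_sumr; under [leRHS]eq_bigl do rewrite ltnNge.
apply: ler_sum => J /andP[Jp JN]; rewrite -ltnNge in JN.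
(* For e(J) > N only b = 0 is left and 0^(n-1) = 0, so the whole main term h(J) V^n / n counts as
   error. *)
rewrite divn_small // big_ord1 expr0n -subn1 subn_eq0 leqNgt n1 !mulr0 sub0r normrN.
rewrite normrM !ger0_norm ?weight_ge0 ?divr_ge0 ?exprn_ge0 ?(ltW V0) //.
rewrite ler_wpM2r ?weight_ge0 // ler_pdivrMr ?ltr0n //.
by rewrite ler_peMr ?exprn_ge0 ?(ltW V0) // ler1n.
Qed.

End Expansion.

(** * The limit of the products and the size of the error *)

Section Asymptotics.
Variables (R : realType) (n : nat).
Hypothesis n1 : (1 < n)%N.

Lemma cvg_sum_theta_term :
  cvgn (fun m : nat => \sum_(0 <= p < m | prime p) `|theta_term R n p|).
Proof.
apply: nondecreasing_is_cvgn.
  apply/nondecreasing_seqP => m; rewrite [leRHS]big_mkcond big_nat_recr //= -big_mkcond.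
  by rewrite lerDl; case: ifP.
(* The bound is [theta_term_le] followed by [sum_inv_sqr_le] at k = 0. *)
exists (2 * (2 / 1%:R)) => _ [m _ <-].
apply: le_trans (ler_wpM2l _ (sum_inv_sqr_le R 0 m)) => //.
rewrite mulr_sumr big_mkcond [leRHS]big_mkcond big_mkord big_ord_recr /=.
apply: ler_wpDr; first by case: ifP => // _; rewrite mulr_ge0 ?invr_ge0 ?exprn_ge0.
apply: ler_sum => p _; case: (boolP (prime p)) => [pp|_].
  by rewrite prime_gt0 // ger0_norm ?theta_term_ge0 ?theta_term_le.
by case: ifP => // _; rewrite mulr_ge0 ?invr_ge0 ?exprn_ge0.
Qed.

Let prods m : R := \prod_(0 <= p < m | prime p) (1 + theta_term R n p).

Lemma prods_ge1 m : 1 <= prods m.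
Proof.
rewrite /prods big_mkord; elim/big_ind: _ => // [x y x1 y1|p pp].
  by rewrite -[1]mulr1 ler_pM.
by rewrite lerDl theta_term_ge0.
Qed.

Lemma prods_nondecreasing : {homo prods : a b / (a <= b)%N >-> a <= b}.
Proof.
apply/nondecreasing_seqP => m.
rewrite /prods [leRHS]big_mkcond big_nat_recr //= -big_mkcond -/(prods m).
rewrite ler_peMr ?(le_trans ler01 (prods_ge1 m)) //.
by case: ifP => // pp; rewrite lerDl theta_term_ge0.
Qed.

Lemma prods_bounds N m (V : R) : (0 < N)%N -> (N < m)%N -> N%:R <= V -> V < N.+1%:R ->
  `|(\sum_(1 <= d < N.+1) #|` latfset n d|)%N%:R - V ^+ n / n%:R * prods m| <=
  V ^+ n.-1 * harmonic R N ^+ 2 + V ^+ n * (2 * harmonic R N / N%:R + 4 / N.+1%:R).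
Proof. by rewrite /prods big_mkord; apply: main_inequality. Qed.

(* Boundedness comes from [main_inequality] at V = 1. *)
Lemma cvg_prods : cvgn prods.
Proof.
apply: nondecreasing_is_cvgn prods_nondecreasing _.
have n0 : 0 < n%:R :> R by rewrite ltr0n ltnW.
pose c : R := (\sum_(1 <= d < 2) #|` latfset n d|)%N%:R.
pose B : R := 1 ^+ n.-1 * harmonic R 1 ^+ 2 + 1 ^+ n * (2 * harmonic R 1 / 1%:R + 4 / 2%:R).
exists (n%:R * (c + B)) => _ [m _ <-].
(* The index is raised to m + 2 so that it exceeds N = 1, as [prods_bounds] requires. *)
apply: le_trans (prods_nondecreasing (leq_addr 2 m)) _.
have := @prods_bounds 1 (m + 2) 1 isT _ (lexx _) (_ : 1 < 2%:R).
rewrite ltn_addl // ltr1n => /(_ isT isT); rewrite -/c -/B expr1n mul1r.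
rewrite ler_norml => /andP[h _]; rewrite mulrC -ler_pdivrMr // mulrC.
by lra.
Qed.

(** The bound of [prods_bounds] holds for every m > N and is free of m. Solved for the partial
    product, it gives a lower and an upper bound that pass to the limit. *)
Lemma theta_bounds N (V : R) : (0 < N)%N -> N%:R <= V -> V < N.+1%:R ->
  `|(\sum_(1 <= d < N.+1) #|` latfset n d|)%N%:R - theta R n / n%:R * V ^+ n| <=
  V ^+ n.-1 * harmonic R N ^+ 2 + V ^+ n * (2 * harmonic R N / N%:R + 4 / N.+1%:R).
Proof.
move=> N0 NV VN; have n0 : 0 < n%:R :> R by rewrite ltr0n ltnW.
have V0 : 0 < V by apply: lt_le_trans NV; rewrite ltr0n.
have K0 : 0 < V ^+ n / n%:R by rewrite divr_gt0 ?exprn_gt0.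
set c := (\sum_(_ <= _ < _) _)%N%:R; set B := _ + _ * (_ + _).
have -> : theta R n / n%:R * V ^+ n = V ^+ n / n%:R * theta R n.
  by rewrite [RHS]mulrC [V ^+ n / _]mulrC mulrA.
have near_bound : \forall m \near \oo, `|c - V ^+ n / n%:R * prods m| <= B.
  by near=> m; apply: prods_bounds => //; near: m; exists N.+1.
have lo : (c - B) / (V ^+ n / n%:R) <= theta R n.
  apply: limr_ge; first exact: cvg_prods.
  near=> m; rewrite ler_pdivrMr // mulrC.
  have : `|c - V ^+ n / n%:R * prods m| <= B by near: m.
  by rewrite ler_norml /prods => /andP[_ h]; lra.
have hi : theta R n <= (c + B) / (V ^+ n / n%:R).
  apply: limr_le; first exact: cvg_prods.
  near=> m; rewrite ler_pdivlMr // mulrC.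
  have : `|c - V ^+ n / n%:R * prods m| <= B by near: m.
  by rewrite ler_norml /prods => /andP[h _]; lra.
rewrite ler_pdivrMr // mulrC in lo; rewrite ler_pdivlMr // mulrC in hi.
by rewrite ler_norml; apply/andP; split; lra.
Unshelve. all: by end_near.
Qed.

(** The induction step is ln (1 + y) <= y at y = - 1 / (N + 2), that is 1 / (N + 2) <= ln (N + 2) -
    ln (N + 1). *)
Lemma harmonic_le_ln N : (0 < N)%N -> harmonic R N <= 1 + ln N%:R.
Proof.
elim: N => // -[|N] IH _.
  by rewrite /harmonic !big_ord_recr big_ord0 /= invr0 add0r invr1 ln1 addr0 add0r.
rewrite /harmonic big_ord_recr /= -/(harmonic R N.+1).
apply: le_trans (lerD (IH isT) (lexx _)) _; rewrite -addrA lerD2l.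
have x0 : 0 < N.+2%:R :> R by rewrite ltr0n.
have : ln (1 + - N.+2%:R^-1) <= - N.+2%:R^-1 :> R.
  by apply: le_ln1Dx; rewrite ltrN2 invf_lt1 // ltr1n.
have -> : 1 + - N.+2%:R^-1 = N.+1%:R / N.+2%:R :> R.
  by rewrite -{1}(mulfV (lt0r_neq0 x0)) -[X in _ + - X]mul1r -mulrBl -natr1 addrK.
rewrite ln_div ?posrE ?ltr0n //=.
move: (ln _) (ln _) (_^-1) => a b c; lra.
Qed.

(** Since V <= 2 N and V <= N + 1, dividing by V^(n-1) leaves at most H^2 + 4 H + 4 = (H + 2)^2 with
    H the harmonic sum, and H + 2 <= 3 (1 + ln V) yields the constant 9. *)
Lemma error_bound N (V : R) : (0 < N)%N -> N%:R <= V -> V < N.+1%:R ->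
  V ^+ n.-1 * harmonic R N ^+ 2 + V ^+ n * (2 * harmonic R N / N%:R + 4 / N.+1%:R) <=
  9 * (V ^+ n.-1 * (1 + ln V) ^+ 2).
Proof.
move=> N0 NV VN; have NR : 1 <= N%:R :> R by rewrite ler1n.
have V0 : 0 < V by lra.
have H0 := harmonic_ge0 R N.
have HV : harmonic R N <= 1 + ln V.
  apply: le_trans (harmonic_le_ln N0) _; rewrite lerD2l ler_ln ?posrE //; lra.
have l0 : 0 <= ln V by apply: ln_ge0; lra.
have NS : N.+1%:R = N%:R + 1 :> R by rewrite natr1.
have -> : V ^+ n = V ^+ n.-1 * V by rewrite -exprSr prednK // ltnW.
rewrite -[V ^+ n.-1 * V * _]mulrA -mulrDr [leRHS]mulrCA ler_wpM2l ?exprn_ge0 ?(ltW V0) //.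
have h1 : V * (2 * harmonic R N / N%:R) <= 4 * harmonic R N.
  have V2 : V <= 2 * N%:R by lra.
  rewrite mulrA ler_pdivrMr; last by lra.
  by have := ler_wpM2l H0 V2; move: (harmonic R N) (N%:R : R) => H x h; nra.
have h2 : V * (4 / N.+1%:R) <= 4.
  by rewrite mulrA ler_pdivrMr NS; lra.
rewrite mulrDr; apply: le_trans (lerD (lexx _) (lerD h1 h2)) _.
move: (harmonic R N) (ln V) H0 HV l0 {h1 h2} => H l H0 HV l0.
have -> : H ^+ 2 + (4 * H + 4) = (H + 2) ^+ 2 by rewrite !expr2; lra.
have -> : 9 * (1 + l) ^+ 2 = (3 * (1 + l)) ^+ 2 by rewrite !expr2; lra.
by rewrite lerXn2r ?nnegrE //; lra.
Qed.

(* With s = sqrt (ln V), the right-hand side is (exp s)^4 >= (1 + s)^4. *)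
Lemma ln_sqr_le_powR (V : R) : 1 < V ->
  (1 + ln V) ^+ 2 <= V `^ (4 / Num.sqrt (ln V)).
Proof.
move=> V1; have l0 : 0 < ln V by apply: ln_gt0.
have s0 : 0 < Num.sqrt (ln V) by rewrite sqrtr_gt0.
have sl := sqr_sqrtr (ltW l0).
have -> : V `^ (4 / Num.sqrt (ln V)) = expR (Num.sqrt (ln V)) ^+ 4.
  rewrite /powR gt_eqF ?(lt_trans ltr01) // -expRM_natl -{2}sl expr2.
  by rewrite mulrA divfK ?lt0r_neq0.
rewrite (exprM _ 2 2) lerXn2r ?nnegrE ?exprn_ge0 ?expR_ge0 //; first by lra.
rewrite -{1}sl; move: (Num.sqrt (ln V)) s0 {sl} => s s0.
apply: le_trans (_ : (1 + s) ^+ 2 <= _); first by rewrite !expr2; lra.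
by rewrite lerXn2r ?nnegrE ?expR_ge0 ?expR_ge1Dx //; lra.
Qed.

End Asymptotics.

Lemma cvg_inv_sqrt_ln (R : realType) (c : R) : 0 < c ->
  c / Num.sqrt (ln V) @[V --> +oo] --> (0 : R).
Proof.
(* The quotient is below e as soon as ln V > (c / e)^2. *)
move=> c0; apply/cvgrPdist_lt => e e0; near=> V.
have V1 : expR ((c / e) ^+ 2) < V.
  by near: V; apply: nbhs_pinfty_gt; rewrite num_real.
have ce : 0 < c / e by rewrite divr_gt0.
have lV : (c / e) ^+ 2 < ln V.
  by rewrite -[X in X < _]expRK ltr_ln ?posrE ?expR_gt0 // (lt_trans _ V1) ?expR_gt0.
have sV : c / e < Num.sqrt (ln V).
  rewrite -[X in X < _]ger0_norm ?(ltW ce) // -sqrtr_sqr ltr_sqrt //.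
  by apply: lt_trans lV; rewrite exprn_gt0.
have s0 := lt_trans ce sV.
rewrite sub0r normrN ger0_norm ?divr_ge0 ?(ltW c0) ?(ltW s0) //.
by rewrite ltr_pdivrMr // mulrC -ltr_pdivrMr.
Unshelve. all: by end_near.
Qed.

Theorem theorem2p1 (R : realType) (n : nat) (hn : (2 <= n)%N) :
  [/\ cvgn (fun m : nat => \sum_(0 <= p < m | prime p) `|theta_term R n p|),
      forall V : R, 1 <= V -> finite_set (cocyclic_subgroups n V)
    & exists2 eps : R -> R,
        eps V @[V --> +oo] --> (0 : R)
      & (fun V : R => (count_cocyclic n V)%:R - theta R n / n%:R * V ^+ n)
          =O_+oo (fun V : R => V `^ (n%:R - 1 + eps V))].
Proof.
have trunc_le (V : R) d : 1 <= V -> (d%:R <= V) = (d <= Num.truncn V)%N.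
  by move=> V1; rewrite truncn_ge_nat // (le_trans ler01).
split; first exact: cvg_sum_theta_term.
  move=> V V1; rewrite (cocyclic_subgroupsE n (fun d => trunc_le V d V1)).
  exact: finite_fset.
(* By [ln_sqr_le_powR], V raised to this exponent absorbs the factor (1 + ln V)^2. *)
exists (fun V => 4 / Num.sqrt (ln V)); first exact: cvg_inv_sqrt_ln.
(* The constant is that of [error_bound]. *)
apply/eqO_exP; exists 9 => //; near=> V.
have V1 : 1 < V by near: V; apply: nbhs_pinfty_gt; rewrite num_real.
have V0 : 0 < V by apply: lt_trans V1.
rewrite (count_cocyclicE n (fun d => trunc_le V d (ltW V1))).
have N0 : (0 < Num.truncn V)%N by rewrite -trunc_le ltW.
have /andP[NV VN] := truncn_itv (ltW V0).
apply: le_trans (theta_bounds hn N0 NV VN) _.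
apply: le_trans (error_bound hn N0 NV VN) _.
rewrite ler_wpM2l // ger0_norm ?powR_ge0 //.
rewrite powRD ?(gt_eqF V0) ?implybT //.
have -> : n%:R - 1 = n.-1%:R :> R by rewrite -subn1 natrB // ltnW.
rewrite powR_mulrn ?(ltW V0) // ler_wpM2l ?exprn_ge0 ?(ltW V0) //.
exact: ln_sqr_le_powR.
Unshelve. all: by end_near.
Qed.
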